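(* Let $S$ be a finite orthodox semigroup. Then $S$ has a permutation matching if and only if for each $a\in S$ the maximal rectangular subbands of the set of non-zero elements of the $0$-rectangular band $(D_a\cup\{0\})/\mathcal{H}$ are pairwise similar.
   Context: For an element $a$ of a semigroup $S$, $V(a)=\{b\in S: aba=a,\ bab=b\}$. $S$ is regular if $V(a)\neq\emptyset$ for all $a$, and orthodox if it is regular and its idempotents form a subsemigroup. A permutation matching of a regular semigroup $S$ is a bijection $f:S\to S$ with $f(a)\in V(a)$ for all $a\in S$. $\mathcal{H},\mathcal{L},\mathcal{R},\mathcal{D}$ are Green's relations and $D_a$ is the $\mathcal{D}$-class of $a$. The principal factor $D_a\cup\{0\}$ is the semigroup on $D_a$ together with a (new) zero $0$, in which the product of $x,y\in D_a$ is $xy$ if $xy\in D_a$ and is $0$ otherwise. For $S$ finite regular this is a completely $0$-simple semigroup, $\mathcal{H}$ is a congruence on it, and the quotient $(D_a\cup\{0\})/\mathcal{H}$ is a $0$-rectangular band, i.e. a completely $0$-simple semigroup with trivial $\mathcal{H}$-relation. A rectangular band is a semigroup satisfying $xyx=x$ for all $x,y$. A maximal rectangular subband of the non-zero part $D=T\setminus\{0\}$ of a $0$-rectangular band $T$ is a subsemigroup of $T$ contained in $D$ that is a rectangular band and is maximal (under inclusion) with this property. Two finite rectangular bands $U_1,U_2$, where $U_i$ has $m_i$ $\mathcal{R}$-classes and $n_i$ $\mathcal{L}$-classes, are similar if $\frac{m_1}{n_1}=\frac{m_2}{n_2}$. *)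

(* Defs.v *)
From HB Require Import structures.
From mathcomp Require Import all_boot all_order all_algebra.

Set Implicit Arguments.
Unset Strict Implicit.
Unset Printing Implicit Defensive.

Local Open Scope group_scope.
Local Open Scope quotient_scope.

#[short(type="finSemigroupType")]
HB.structure Definition FinSemigroup := {S of Semigroup S & Finite S}.

Section Semigroups.
Variable S : semigroupType.

Definition inverse_of (a b : S) : Prop := a * b * a = a /\ b * a * b = b.

Definition regular_semigroup : Prop := forall a : S, exists b, inverse_of a b.

Definition idempotent_elt (e : S) : Prop := e * e = e.

Definition orthodox_semigroup : Prop :=
  regular_semigroup /\
  forall e f : S, idempotent_elt e -> idempotent_elt f -> idempotent_elt (e * f).

Definition permutation_matching (f : S -> S) : Prop :=
  bijective f /\ forall a, inverse_of a (f a).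

End Semigroups.

Section Green.
Variable S : finSemigroupType.
Implicit Types (A U : {set S}) (x y z : S).

(* When A is a subsemigroup and x, y \in A, the relations green_ A x y below
   are those of A itself, not the restrictions to A of those of S.           *)
Definition right_ideal A x : {set S} := x |: [set x * s | s in A].
Definition left_ideal A x : {set S} := x |: [set s * x | s in A].

Definition greenR A : rel S := fun x y => right_ideal A x == right_ideal A y.
Definition greenL A : rel S := fun x y => left_ideal A x == left_ideal A y.
Definition greenH A : rel S := fun x y => greenL A x y && greenR A x y.
Definition greenD A : rel S :=
  fun x y => [exists z in A, greenL A x z && greenR A z y].

Definition Dclass (a : S) : {set S} := [set x | greenD [set: S] a x].

Definition subsemigroup U : bool :=
  (U != set0) && [forall x in U, forall y in U, x * y \in U].

Definition rectangular_subband U : bool :=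
  subsemigroup U && [forall x in U, forall y in U, x * y * x == x].

Definition maximal_rectangular_subband A U : bool :=
  maxset (fun V => rectangular_subband V && (V \subset A)) U.

Definition num_Rclasses U : nat := #|equivalence_partition (greenR U) U|.
Definition num_Lclasses U : nat := #|equivalence_partition (greenL U) U|.

Definition similar_bands U1 U2 : Prop :=
  ((num_Rclasses U1)%:R / (num_Lclasses U1)%:R)%R
  = ((num_Rclasses U2)%:R / (num_Lclasses U2)%:R)%R :> rat.

Lemma greenH_refl A : reflexive (greenH A).
Proof. by move=> x; rewrite /greenH /greenL /greenR !eqxx. Qed.

Lemma greenH_sym A : symmetric (greenH A).
Proof. by move=> x y; rewrite /greenH /greenL /greenR ![_ _ x == _]eq_sym. Qed.

Lemma greenH_trans A : transitive (greenH A).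
Proof.
move=> y x z /andP[/eqP lxy /eqP rxy] /andP[/eqP lyz /eqP ryz].
by rewrite /greenH /greenL /greenR lxy rxy lyz ryz !eqxx.
Qed.

Definition greenH_equiv_rel A :=
  EquivRel (greenH A) (greenH_refl A) (greenH_sym A) (@greenH_trans A).

End Green.

Section GreenTheory.
Variable S : finSemigroupType.
Implicit Types (x y z a : S) (u v w : option S).

Notation RI := (right_ideal [set: S]).
Notation LI := (left_ideal [set: S]).

(* The action of S with an identity adjoined. *)
Let rm x u := if u is Some s then x * s else x.
Let lm u x := if u is Some s then s * x else x.
Let om u v := if u is Some s then Some (rm s v) else v.

Let rmA x u v : rm (rm x u) v = rm x (om u v).
Proof. by case: u v => [s|] [t|] //=; rewrite -mulgA. Qed.
Let lmA u v x : lm u (lm v x) = lm (om u v) x.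
Proof. by case: u v => [s|] [t|] //=; rewrite mulgA. Qed.
Let lrm u x v : lm u (rm x v) = rm (lm u x) v.
Proof. by case: u v => [s|] [t|] //=; rewrite mulgA. Qed.

Let RIP x y : reflect (exists u, x = rm y u) (x \in RI y).
Proof.
apply: (iffP setU1P) => [[->|/imsetP[s _ ->]]|[[s|] /= ->]].
- by exists None.
- by exists (Some s).
- by right; apply: imset_f.
- by left.
Qed.

Let LIP x y : reflect (exists u, x = lm u y) (x \in LI y).
Proof.
apply: (iffP setU1P) => [[->|/imsetP[s _ ->]]|[[s|] /= ->]].
- by exists None.
- by exists (Some s).
- by right; apply: (imset_f (fun s => s * y)).
- by left.
Qed.

Let RI_rm x u : RI (rm x u) \subset RI x.
Proof.
by apply/subsetP => _ /RIP[v ->]; apply/RIP; exists (om u v); rewrite rmA.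
Qed.
Let LI_lm u x : LI (lm u x) \subset LI x.
Proof.
by apply/subsetP => _ /LIP[v ->]; apply/LIP; exists (om v u); rewrite lmA.
Qed.

Let greenRW x y : greenR setT x y -> exists u, x = rm y u.
Proof. by move/eqP=> e; apply/RIP; rewrite -e; apply/RIP; exists None. Qed.
Let greenLW x y : greenL setT x y -> exists u, x = lm u y.
Proof. by move/eqP=> e; apply/LIP; rewrite -e; apply/LIP; exists None. Qed.
Let greenRI x y u v : x = rm y u -> y = rm x v -> greenR setT x y.
Proof. by move=> e f; rewrite /greenR eqEsubset {1}e RI_rm f RI_rm. Qed.
Let greenLI x y u v : x = lm u y -> y = lm v x -> greenL setT x y.
Proof. by move=> e f; rewrite /greenL eqEsubset {1}e LI_lm f LI_lm. Qed.

Let greenRMl z x y : greenR setT x y -> greenR setT (z * x) (z * y).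
Proof.
move=> r; have [u e] := greenRW r.
have [v f] : exists v, y = rm x v by apply: greenRW; rewrite /greenR eq_sym.
apply: (@greenRI _ _ u v).
- by rewrite {1}e; apply: (lrm (Some z)).
- by rewrite {1}f; apply: (lrm (Some z)).
Qed.
Let greenLMr z x y : greenL setT x y -> greenL setT (x * z) (y * z).
Proof.
move=> r; have [u e] := greenLW r.
have [v f] : exists v, y = lm v x by apply: greenLW; rewrite /greenL eq_sym.
apply: (@greenLI _ _ u v).
- by rewrite {1}e; rewrite (lrm u y (Some z)).
- by rewrite {1}f; rewrite (lrm v x (Some z)).
Qed.

Let jle x y := exists u v, x = lm u (rm y v).

Let jlexx x : jle x x. Proof. by exists None, None. Qed.
Let jle_trans y x z : jle x y -> jle y z -> jle x z.
Proof.
move=> [u [v ->]] [u' [v' ->]]; exists (om u u'), (om v' v).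
by rewrite -lrm rmA lmA.
Qed.
Let jle_rm x u : jle (rm x u) x. Proof. by exists None, u. Qed.
Let jle_lm x u : jle (lm u x) x. Proof. by exists u, None. Qed.

(* Stability of finite semigroups. *)
Let stabR x u : jle x (rm x u) -> greenR setT x (rm x u).
Proof.
move=> [v [w e]]; rewrite /greenR eq_sym eqEcard RI_rm /=.
have sub : RI x \subset lm v @: RI (rm x u).
  apply/subsetP => _ /RIP[s ->]; rewrite {1}e -lrm; apply: imset_f.
  by rewrite rmA; apply/RIP; exists (om w s).
by apply: leq_trans (subset_leq_card sub) (leq_imset_card _ _).
Qed.
Let stabL x u : jle x (lm u x) -> greenL setT x (lm u x).
Proof.
move=> [v [w e]]; rewrite /greenL eq_sym eqEcard LI_lm /=.
have sub : LI x \subset (fun y => rm y w) @: LI (lm u x).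
  apply/subsetP => _ /LIP[s ->]; rewrite {1}e lrm lrm.
  apply: (imset_f (fun y => rm y w)).
  by rewrite lmA; apply/LIP; exists (om s v).
by apply: leq_trans (subset_leq_card sub) (leq_imset_card _ _).
Qed.

Let DP a x : reflect (jle a x /\ jle x a) (x \in Dclass a).
Proof.
rewrite inE; apply: (iffP existsP).
- move=> [z /and3P[_ l r]].
  have [u e] := greenLW l; have [v f] := greenRW r.
  have [u' e'] : exists u, z = lm u a by apply: greenLW; rewrite /greenL eq_sym.
  have [v' f'] : exists v, x = rm z v by apply: greenRW; rewrite /greenR eq_sym.
  split; first by exists u, v; rewrite -f.
  by exists u', v'; rewrite lrm -e'.
- move=> [[u [v e]] xa]; exists (rm x v); rewrite inE /=; apply/andP; split.
  + have h : jle (rm x v) (lm u (rm x v)).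
      by rewrite -e; apply: jle_trans xa; apply: jle_rm.
    by rewrite e /greenL eq_sym; apply: stabL.
  + rewrite /greenR eq_sym; apply: stabR; apply: jle_trans xa _.
    by exists u, None.
Qed.

Lemma Dclass_mull a x y z :
  x \in Dclass a -> x * y * z \in Dclass a -> x * y \in Dclass a.
Proof.
move=> /DP[ax xa] /DP[h _]; apply/DP; split.
  by apply: jle_trans h _; apply: (jle_rm _ (Some z)).
by apply: jle_trans xa; apply: (jle_rm _ (Some y)).
Qed.

Lemma Dclass_mulr a x y z :
  z \in Dclass a -> x * (y * z) \in Dclass a -> y * z \in Dclass a.
Proof.
move=> /DP[ax xa] /DP[h _]; apply/DP; split.
  by apply: jle_trans h _; apply: (jle_lm _ (Some x)).
by apply: jle_trans xa; apply: (jle_lm _ (Some y)).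
Qed.

(* In the D-class of a, a nonzero product x * z is R-related to x by a
   multiplier taken from that D-class, and dually.                           *)
Lemma Dclass_divr a x z :
    x \in Dclass a -> z \in Dclass a -> x * z \in Dclass a ->
  exists2 w, w \in Dclass a & x = x * z * w.
Proof.
move=> /DP[ax xa] /DP[az za] /DP[axz xza].
have /greenRW[[s|] /= e] : greenR setT x (x * z).
  by apply: (@stabR x (Some z)); apply: jle_trans xa axz.
- exists (s * z * s); last by rewrite !mulgA -e -e.
  apply/DP; split.
    apply: jle_trans ax _; exists (Some (x * z)), None => /=.
    by rewrite !mulgA -e -e.
  by apply: jle_trans za; exists (Some s), (Some s); rewrite /= mulgA.
- by exists z; [apply/DP | rewrite -e].
Qed.

Lemma Dclass_divl a x z :
    x \in Dclass a -> z \in Dclass a -> z * x \in Dclass a ->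
  exists2 w, w \in Dclass a & x = w * (z * x).
Proof.
move=> /DP[ax xa] /DP[az za] /DP[axz xza].
have /greenLW[[s|] /= e] : greenL setT x (z * x).
  by apply: (@stabL x (Some z)); apply: jle_trans xa axz.
- exists (s * z * s); last by rewrite -!mulgA -e -e.
  apply/DP; split.
    apply: jle_trans ax _; exists None, (Some (z * x)) => /=.
    by rewrite -!mulgA -e -e.
  by apply: jle_trans za; exists (Some s), (Some s); rewrite /= mulgA.
- by exists z; [apply/DP | rewrite -e].
Qed.

Lemma greenRP x y :
  reflect ((x = y \/ exists s, x = y * s) /\ (x = y \/ exists s, y = x * s))
    (greenR [set: S] x y).
Proof.
apply: (iffP idP) => [r|].
  have [u e] := greenRW r.
  have [v f] : exists v, y = rm x v by apply: greenRW; rewrite /greenR eq_sym.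
  split; first by case: u e => [s|]; [right; exists s | left].
  by case: v f => [s|]; [right; exists s | left].
move=> [[->|[s e]]] => [_|]; first by rewrite /greenR eqxx.
move=> [->|[t f]]; first by rewrite /greenR eqxx.
exact: (@greenRI _ _ (Some s) (Some t)).
Qed.

Lemma greenLP x y :
  reflect ((x = y \/ exists s, x = s * y) /\ (x = y \/ exists s, y = s * x))
    (greenL [set: S] x y).
Proof.
apply: (iffP idP) => [r|].
  have [u e] := greenLW r.
  have [v f] : exists v, y = lm v x by apply: greenLW; rewrite /greenL eq_sym.
  split; first by case: u e => [s|]; [right; exists s | left].
  by case: v f => [s|]; [right; exists s | left].
move=> [[->|[s e]]] => [_|]; first by rewrite /greenL eqxx.
move=> [->|[t f]]; first by rewrite /greenL eqxx.
exact: (@greenLI _ _ (Some s) (Some t)).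
Qed.

Lemma greenR_mul2l z x y :
  greenR [set: S] x y -> greenR [set: S] (z * x) (z * y).
Proof. exact: greenRMl. Qed.

Lemma greenL_mul2r z x y :
  greenL [set: S] x y -> greenL [set: S] (x * z) (y * z).
Proof. exact: greenLMr. Qed.

End GreenTheory.

Definition principal_factor (S : finSemigroupType) (a : S) : Type :=
  option {x : S | x \in Dclass a}.

Section PrincipalFactor.
Variables (S : finSemigroupType) (a : S).
Notation P := (principal_factor a).

HB.instance Definition _ := Finite.on P.

Definition pf_zero : P := None.

(* insub sends s to None, that is to pf_zero, when s is not in Dclass a. *)
Definition pf_mul (p q : P) : P :=
  if (p, q) is (Some x, Some y) then insub (val x * val y) else pf_zero.

Lemma pf_mulA : associative pf_mul.
Proof.
move=> [x|] [y|] [z|] //=; rewrite /pf_mul; last by case: insub.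
case: (insubP _ (sval y * sval z)) => /= [v vD ev|yzN];
  case: (insubP _ (sval x * sval y)) => /= [w wD ew|xyN] //.
- by rewrite ev ew mulgA.
- rewrite insubN // ev mulgA; apply: contra xyN.
  exact: Dclass_mull (valP x).
- rewrite insubN // ew -mulgA; apply: contra yzN.
  exact: Dclass_mulr (valP z).
Qed.

HB.instance Definition _ := isSemigroup.Build P pf_mulA.

Lemma pf_mulE (p q : P) : p * q = pf_mul p q. Proof. by []. Qed.

Lemma pf_mul0 (p : P) : p * pf_zero = pf_zero. Proof. by case: p. Qed.
Lemma pf_0mul (p : P) : pf_zero * p = pf_zero. Proof. by []. Qed.

Lemma pf_greenR_mulr (p q : P) :
  p * q != pf_zero -> greenR [set: P] p (p * q).
Proof.
case: p q => [x|] [z|] //; rewrite pf_mulE /pf_mul.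
case: insubP => //= v xzD ev _.
have [w wD e] := Dclass_divr (valP x) (valP z) xzD.
apply/greenRP; split; right.
  exists (Some (Sub w wD)); rewrite pf_mulE /pf_mul /= ev -e.
  by rewrite valK.
by exists (Some z); rewrite pf_mulE /pf_mul /= -ev valK.
Qed.

Lemma pf_greenL_mull (p q : P) :
  q * p != pf_zero -> greenL [set: P] p (q * p).
Proof.
case: p q => [x|] [z|] //; rewrite pf_mulE /pf_mul.
case: insubP => //= v xzD ev _.
have [w wD e] := Dclass_divl (valP x) (valP z) xzD.
apply/greenLP; split; right.
  exists (Some (Sub w wD)); rewrite pf_mulE /pf_mul /= ev -e.
  by rewrite valK.
by exists (Some z); rewrite pf_mulE /pf_mul /= -ev valK.
Qed.

Lemma pf_greenL0 (p q : P) : greenL [set: P] p q ->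
  (p == pf_zero) = (q == pf_zero).
Proof.
case/greenLP => h k; apply/eqP/eqP => e; subst.
- by case: k => [|[s ->]] //; rewrite pf_mul0.
- by case: h => [|[s ->]] //; rewrite pf_mul0.
Qed.

Lemma pf_greenR0 (p q : P) : greenR [set: P] p q ->
  (p == pf_zero) = (q == pf_zero).
Proof.
case/greenRP => h k; apply/eqP/eqP => e; subst.
- by case: k => [|[s ->]] //.
- by case: h => [|[s ->]] //.
Qed.

Lemma pf_greenH_mulr (r p q : P) :
  greenH [set: P] p q -> greenH [set: P] (p * r) (q * r).
Proof.
case/andP => hL hR; have hL' := greenL_mul2r r hL; rewrite /greenH hL' /=.
have e := pf_greenL0 hL'; have [p0|pN0] := eqVneq (p * r) pf_zero.
  by move: e; rewrite p0 eqxx => /esym/eqP->; rewrite /greenR.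
have qN0 : q * r != pf_zero by rewrite -e.
have := pf_greenR_mulr pN0; have := pf_greenR_mulr qN0; move: hR.
by rewrite /greenR => /eqP-> /eqP-> /eqP->.
Qed.

Lemma pf_greenH_mull (r p q : P) :
  greenH [set: P] p q -> greenH [set: P] (r * p) (r * q).
Proof.
case/andP => hL hR; have hR' := greenR_mul2l r hR; rewrite /greenH hR' andbT.
have e := pf_greenR0 hR'; have [p0|pN0] := eqVneq (r * p) pf_zero.
  by move: e; rewrite p0 eqxx => /esym/eqP->; rewrite /greenL.
have qN0 : r * q != pf_zero by rewrite -e.
have := pf_greenL_mull pN0; have := pf_greenL_mull qN0; move: hL.
by rewrite /greenL => /eqP-> /eqP-> /eqP->.
Qed.

Lemma pf_greenH_mul (p p' q q' : P) :
  greenH [set: P] p p' -> greenH [set: P] q q' ->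
  greenH [set: P] (p * q) (p' * q').
Proof.
move=> hp hq; apply: greenH_trans (pf_greenH_mulr q hp) _.
exact: pf_greenH_mull.
Qed.

End PrincipalFactor.

Definition principal_factor_modH (S : finSemigroupType) (a : S) : Type :=
  {eq_quot greenH_equiv_rel [set: principal_factor a]}.

Section Quotient.
Variables (S : finSemigroupType) (a : S).
Notation P := (principal_factor a).
Notation Q := (principal_factor_modH a).

HB.instance Definition _ := EqQuotient.on Q.
HB.instance Definition _ := Choice.on Q.
HB.instance Definition _ := Countable.copy Q (can_type (@reprK _ Q)).
HB.instance Definition _ : isFinite Q := CanIsFinite (@reprK _ Q).

Definition pfH_mul (p q : Q) : Q := \pi_Q (repr p * repr q).

Lemma pfH_piM (p q : P) : pfH_mul (\pi_Q p) (\pi_Q q) = \pi_Q (p * q).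
Proof.
have pi_repr r : greenH [set: P] (repr (\pi_Q r)) r.
  change (greenH_equiv_rel [set: P] (repr (\pi_Q r)) r).
  apply/eqmodP.
  by rewrite reprK.
by apply/eqmodP; apply: pf_greenH_mul.
Qed.

Lemma pfH_mulA : associative pfH_mul.
Proof.
elim/quotW=> p; elim/quotW=> q; elim/quotW=> r.
rewrite (pfH_piM q r) (pfH_piM p q) (pfH_piM p (q * r)) (pfH_piM (p * q) r).
by rewrite mulgA.
Qed.

HB.instance Definition _ := isSemigroup.Build Q pfH_mulA.

Definition pfH_nonzero : {set Q} := [set~ \pi_Q (pf_zero a)].

End Quotient.

(* Main.v *)
(* In an orthodox semigroup the sets V(a) are pairwise equal or disjoint, so
   they partition S, and for b in V(a) the block of a is V(b). A permutation
   matching maps each block V(b) injectively into V(a), so it exists if and only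
   if |V(a)| = |V(b)| whenever b is an inverse of a.
   If e = ab and f = ba, then |V(a)| = r(e) l(f) and |V(b)| = r(f) l(e), where
   r(e) and l(e) count the idempotents R-related and L-related to e. On the other
   hand the maximal rectangular subbands of the nonzero part of (D u {0})/H are
   the images of the sets V(e) with e an idempotent of D, and such an image has
   l(e) R-classes and r(e) L-classes; any two idempotents of D are of the form
   ab and ba for some mutually inverse a and b. *)
Require Import Defs.
From mathcomp Require Import all_boot all_order all_algebra.

Set Implicit Arguments.
Unset Strict Implicit.
Unset Printing Implicit Defensive.

Local Open Scope group_scope.
Local Open Scope quotient_scope.

(** * Sets of inverses: their sizes, and the blocks they form in the orthodox case *)

Section Inverses.
Variable S : finSemigroupType.
Implicit Types a b c e f g x y z : S.

Definition inverses a : {set S} := [set b | (a * b * a == a) && (b * a * b == b)].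

Lemma inversesP a b : reflect (inverse_of a b) (b \in inverses a).
Proof. by rewrite inE; apply: (iffP andP) => -[/eqP h1 /eqP h2]. Qed.

Lemma inverse_ofC a b : inverse_of a b -> inverse_of b a.
Proof. by case. Qed.

Lemma inversesC a b : (b \in inverses a) = (a \in inverses b).
Proof. by rewrite !inE andbC. Qed.

Lemma inverse_of_idem e : idempotent_elt e -> inverse_of e e.
Proof. by move=> ee; split; rewrite !ee. Qed.

Lemma idem_mul_inverse a b : inverse_of a b -> idempotent_elt (a * b).
Proof. by case=> h _; rewrite /idempotent_elt mulgA h. Qed.

(* For e idempotent these are the idempotents R-related, resp. L-related, to e. *)
Definition Rinverses e : {set S} := [set x in inverses e | e * x == x].
Definition Linverses e : {set S} := [set x in inverses e | x * e == x].

(** Bijection: an inverse [x] of [a] gives the pair [(a * x, x * a)], and a pair [(g, h)] gives back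
    [h * b * g]. *)
Lemma card_inverses a b : inverse_of a b ->
  #|inverses a| = (#|Rinverses (a * b)%g| * #|Linverses (b * a)%g|)%N.
Proof.
move=> [aba bab].
have aba' : a * (b * a) = a by rewrite mulgA.
have key g h : g \in Rinverses (a * b) -> h \in Linverses (b * a) ->
    [/\ a * (h * b * g) = g, h * b * g * a = h & h * b * g \in inverses a].
  rewrite 2!inE => /andP[/andP[/eqP ege _] /eqP eg].
  rewrite 2!inE => /andP[/andP[/eqP fhf _] /eqP hf].
  have ge : g * (a * b) = a * b by rewrite -{1}eg ege.
  have fh : b * a * h = b * a by rewrite -{1}hf mulgA fhf.
  have ga : g * a = a by rewrite -{1}aba mulgA ge aba.
  have ah : a * h = a by rewrite -{1}aba -!mulgA (mulgA b) fh.
  have ax : a * (h * b * g) = g by rewrite !mulgA ah.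
  have xa : h * b * g * a = h by rewrite -!mulgA ga.
  split=> //; apply/inversesP; split; first by rewrite ax ga.
  by rewrite -(mulgA (h * b) g a) ga -mulgA ax.
rewrite -cardsX -[RHS](@card_in_imset _ _ (fun p => p.2 * b * p.1)).
  apply: eq_card => x; apply/idP/imsetP => [/inversesP[axa xax]|].
    exists (a * x, x * a); last first.
      by rewrite /= !mulgA -(mulgA x a b) -(mulgA x) aba xax.
    have axa' : a * (x * a) = a by rewrite mulgA.
    rewrite !inE /=; apply/andP; split.
      by rewrite !mulgA aba axa aba !eqxx.
    by rewrite -!mulgA aba' axa' aba' !eqxx.
  by move=> [[g h] /setXP[gR hL] ->]; have [] := key g h gR hL.
move=> [g h] [g' h'] /setXP[gR hL] /setXP[gR' hL'] /= E.
have [eg eh _] := key g h gR hL; have [eg' eh' _] := key g' h' gR' hL'.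
by congr (_, _); [rewrite -eg -eg' E | rewrite -eh -eh' E].
Qed.

Hypothesis orthS : orthodox_semigroup S.

Let idemM e f : idempotent_elt e -> idempotent_elt f -> idempotent_elt (e * f).
Proof. exact: orthS.2. Qed.

(* The hypotheses on g say that e R g L f. *)
Lemma orthodox_corner e f g : idempotent_elt e -> idempotent_elt f ->
  e * g = g -> g * e = e -> f * g = f -> g * f = g -> e * f = g.
Proof.
move=> ee ff eg ge fg gf; have := idemM ff ee; rewrite /idempotent_elt => hh.
(* With [e = g(fe)] and [f = (fe)g], the product [ef] becomes [g(fe)(fe)g], which collapses because
   [fe] is idempotent. *)
have <- : g * (f * e) = e by rewrite mulgA gf ge.
have {2}<- : f * e * g = f by rewrite -mulgA eg fg.
by rewrite -mulgA (mulgA (f * e)) hh 2!mulgA gf ge eg.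
Qed.

(** This is where orthodoxy enters the partition into blocks: the ends of a path of three inverse
    pairs are again mutually inverse. Reversing the path exchanges the two equations, so only
    [b * x * b = b] needs work. *)
Lemma inverse_of_path b c a x :
  inverse_of b c -> inverse_of c a -> inverse_of a x -> inverse_of b x.
Proof.
suff H b' c' a' x' : inverse_of b' c' -> inverse_of c' a' -> inverse_of a' x' ->
    b' * x' * b' = b'.
  move=> bc ca ax; split; first exact: H bc ca ax.
  exact: H (inverse_ofC ax) (inverse_ofC ca) (inverse_ofC bc).
move: b' c' a' x' => {}b {}c {}a {}x bc ca ax.
(* [c * b] is R-related to [c * a] through [c], and [c * a] is L-related to [x * a] through [a], so
   [c * a] is the corner. The next identity is the dual one, with corner [a * c]. *)
have cbxa : c * b * (x * a) = c * a.
  apply: orthodox_corner;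
    [exact/idem_mul_inverse/inverse_ofC | exact/idem_mul_inverse/inverse_ofC | ..];
    case: bc ca ax => [bcb cbc] [cac aca] [axa xax].
  - by rewrite mulgA cbc.
  - by rewrite mulgA cac.
  - by rewrite -!mulgA (mulgA a) aca.
  - by rewrite -!mulgA (mulgA a) axa.
have axbc : a * x * (b * c) = a * c.
  apply: orthodox_corner; [exact/idem_mul_inverse | exact/idem_mul_inverse | ..];
    case: bc ca ax => [bcb cbc] [cac aca] [axa xax].
  - by rewrite mulgA axa.
  - by rewrite mulgA aca.
  - by rewrite -!mulgA (mulgA c) cac.
  - by rewrite -!mulgA (mulgA c) cbc.
case: bc ca ax => [bcb cbc] [cac aca] [axa xax].
(* Writing [x] as [x * a * x] lets both corner identities apply. *)
have cbxbc : c * b * x * (b * c) = c.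
  by rewrite -{1}xax !mulgA -(mulgA (c * b)) cbxa -!mulgA (mulgA a) axbc mulgA.
have -> : b * x * b = b * (c * b * x * (b * c)) * b.
  by rewrite !mulgA bcb -!mulgA (mulgA b c b) bcb.
by rewrite cbxbc.
Qed.

(** For [x] inverse to [a], the path [b], [c], [a], [x] makes [x] inverse to [b]. *)
Lemma eq_inverses a b c : c \in inverses a -> c \in inverses b -> inverses a = inverses b.
Proof.
suff H a' b' : c \in inverses a' -> c \in inverses b' ->
    inverses a' \subset inverses b'.
  by move=> ca cb; apply/eqP; rewrite eqEsubset !H.
move=> /inversesP ca /inversesP cb; apply/subsetP => x /inversesP ax.
by apply/inversesP; apply: inverse_of_path cb (inverse_ofC ca) ax.
Qed.

Lemma inverses_class a b : inverse_of a b ->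
  inverses b = [set x | inverses x == inverses a].
Proof.
move=> /inversesP ab; apply/setP => x; rewrite inE -inversesC.
apply/idP/eqP => [bx | ->//]; exact: eq_inverses bx ab.
Qed.

Lemma permutation_matching_card :
  (exists f : S -> S, permutation_matching f) <->
  (forall a b, inverse_of a b -> #|inverses a| = #|inverses b|).
Proof.
split=> [[f [/bij_inj f_inj f_inv]] | card_eq].
  suff H a b : inverse_of a b -> #|inverses a| <= #|inverses b|.
    by move=> a b ab; apply/eqP; rewrite eqn_leq !H //; apply: inverse_ofC.
  move=> /inverse_ofC ba; rewrite (inverses_class ba) -(card_imset _ f_inj).
  apply/subset_leq_card/subsetP => _ /imsetP[x + ->]; rewrite inE => /eqP <-.
  exact/inversesP.
pose C a := [set x | inverses x == inverses a].
have cardC a : #|C a| = #|inverses a|.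
  by have [b ab] := orthS.1 a; rewrite /C -(inverses_class ab) (card_eq _ _ ab).
(* The enumeration of the block [C x] is matched with that of [inverses x]. Both have the same
   length, so the default of [nth] is never reached. *)
pose f x := nth x (enum (inverses x)) (index x (enum (C x))).
have idx x : index x (enum (C x)) < size (enum (inverses x)).
  by rewrite -cardE -cardC cardE index_mem mem_enum inE.
have fV x : f x \in inverses x by rewrite -mem_enum mem_nth.
exists f; split; last by move=> a; apply/inversesP.
apply: injF_bij => x y fxy.
have Vxy : inverses x = inverses y by apply: (@eq_inverses _ _ (f x)); rewrite // fxy.
have Cxy : C x = C y by rewrite /C Vxy.
have := idx x; have := idx y; move: fxy; rewrite /f -Vxy -Cxy => fxy iy ix.
move/eqP: fxy; rewrite (set_nth_default x y iy) nth_uniq ?enum_uniq // => /eqP eqi.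
have xC : x \in enum (C x) by rewrite mem_enum inE.
have yC : y \in enum (C x) by rewrite mem_enum inE Vxy.
by rewrite -(nth_index x xC) eqi nth_index.
Qed.

(** * The inverses of an idempotent form a rectangular band *)

Section Idempotent.
Variable e : S.
Hypothesis ee : idempotent_elt e.

(** [x = xex = (xe)(ex)] is a product of two idempotents. *)
Lemma inverse_idem_idem x : inverse_of e x -> idempotent_elt x.
Proof.
move=> ex; have [_ <-] := ex.
have -> : x * e * x = x * e * (e * x) by rewrite mulgA -(mulgA x e e) ee.
by apply: idemM; apply: idem_mul_inverse => //; apply: inverse_ofC.
Qed.

Lemma inverses_idem_rect x y :
  inverse_of e x -> inverse_of e y -> inverse_of x y.
Proof.
move=> ex ey; exact: inverse_of_path (inverse_ofC ex) (inverse_of_idem ee) ey.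
Qed.

(** The path is [x * y], [x], [e], [e]; its first link follows from [xyx = x] and [xx = x]. *)
Lemma inverses_idem_mul x y :
  inverse_of e x -> inverse_of e y -> inverse_of e (x * y).
Proof.
move=> ex ey; apply: inverse_ofC.
apply: inverse_of_path (inverse_ofC ex) (inverse_of_idem ee).
have xx := inverse_idem_idem ex; have [xyx _] := inverses_idem_rect ex ey.
by split; [rewrite xyx mulgA xx | rewrite mulgA xx xyx].
Qed.

End Idempotent.
End Inverses.

(** * Green's relations and inverse pairs in a regular semigroup *)

Section RegularGreen.
Variable S : finSemigroupType.
Hypothesis regS : regular_semigroup S.
Implicit Types a b e f x y z : S.

(** Since [z = z * (t * z)] for [t] inverse to [z], the case [x = y] of [greenRP] is also given by a
    multiplier. *)
Lemma regular_greenRP x y :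
  reflect ((exists s, x = y * s) /\ exists s, y = x * s) (greenR [set: S] x y).
Proof.
apply: (iffP (greenRP x y)) => [[h k] | [h k]]; last by split; right.
suff refl z : exists s, z = z * s.
  split; first by case: h => // <-; apply: refl.
  by case: k => // <-; apply: refl.
by have [t [ztz _]] := regS z; exists (t * z); rewrite mulgA.
Qed.

Lemma regular_greenLP x y :
  reflect ((exists s, x = s * y) /\ exists s, y = s * x) (greenL [set: S] x y).
Proof.
apply: (iffP (greenLP x y)) => [[h k] | [h k]]; last by split; right.
suff refl z : exists s, z = s * z.
  split; first by case: h => // <-; apply: refl.
  by case: k => // <-; apply: refl.
by have [t [ztz _]] := regS z; exists (z * t).
Qed.

Lemma Dclass_refl a : a \in Dclass a.
Proof. by rewrite inE; apply/existsP; exists a; rewrite inE /greenL /greenR !eqxx. Qed.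

Lemma Dclass_greenR a x y : x \in Dclass a -> greenR [set: S] x y -> y \in Dclass a.
Proof.
rewrite !inE => /existsP[z /and3P[_ az zx]] xy; apply/existsP; exists z.
by rewrite inE az /=; move: zx xy; rewrite /greenR => /eqP-> /eqP->.
Qed.

(** [greenD] composes L with R in this order, so the two must be commuted: if [y = u * x], left
    multiplication by [u] moves the intermediate [z] within its L-class into the R-class of [y]. *)
Lemma Dclass_greenL a x y : x \in Dclass a -> greenL [set: S] x y -> y \in Dclass a.
Proof.
rewrite !inE => /existsP[z /and3P[_ az]].
move=> /regular_greenRP[[t zE] [s xE]] /regular_greenLP[[v xE'] [u yE]].
apply/existsP; exists (u * z); rewrite inE /=; apply/andP; split.
  move: az; rewrite /greenL => /eqP->; apply/regular_greenLP.
  by split; [exists v; rewrite mulgA zE mulgA -(mulgA v) -yE -xE' | exists u].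
by apply/regular_greenRP; split; [exists t; rewrite zE mulgA -yE
  | exists s; rewrite -mulgA -xE].
Qed.

(** [x] is R-related to [x * y], which is L-related to [y]. *)
Lemma Dclass_inverse a x y : x \in Dclass a -> inverse_of x y -> y \in Dclass a.
Proof.
move=> xD [xyx yxy].
have xyD : x * y \in Dclass a.
  apply: Dclass_greenR xD _; apply/regular_greenRP.
  by split; [exists x | exists y].
apply: Dclass_greenL xyD _; apply/regular_greenLP.
by split; [exists x | exists y; rewrite mulgA].
Qed.

Lemma Dclass_idem_inverse a e f :
    idempotent_elt e -> idempotent_elt f -> e \in Dclass a -> f \in Dclass a ->
  exists b b', [/\ inverse_of b b', b * b' = e & b' * b = f].
Proof.
move=> ee ff; rewrite !inE => /existsP[z /and3P[_ az ze]] /existsP[w /and3P[_ aw wf]].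
have /regular_greenLP[[u zE] [v wE]] : greenL [set: S] z w.
  by move: az aw; rewrite /greenL => /eqP<-.
move/regular_greenRP: ze => [[k zE'] [l eE]].
move/regular_greenRP: wf => [[t wE'] [s fE]].
(* [b] lies in the R-class of [e] and the L-class of [f], and [p] is a right multiplier with
   [b * p = e]; trimming it to [f * p * e] yields the required inverse. *)
pose b := z * s; pose p := t * l.
have bE : b = u * f by rewrite /b zE fE mulgA.
have fb : f = v * b by rewrite /b mulgA -wE.
have eb : e = b * p by rewrite /p mulgA bE -(mulgA u) -wE' -zE -eE.
have bf : b * f = b by rewrite bE -mulgA ff.
have be : e * b = b by rewrite /b mulgA zE' mulgA ee.
clearbody b p.
have bbe : b * (f * p * e) = e by rewrite !mulgA bf -eb ee.
have bbf : f * p * e * b = f.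
  by rewrite -2!mulgA be {1}fb mulgA -(mulgA v) -eb -mulgA be -fb.
exists b, (f * p * e); split=> //; split; first by rewrite bbe be.
by rewrite bbf !mulgA ff.
Qed.

End RegularGreen.

(** * Counting the R-classes and L-classes of a rectangular band *)

Section RectangularBand.
Variables (T : finSemigroupType) (U : {set T}).
Hypothesis rectU : rectangular_subband U.
Implicit Types x y u : T.

Lemma rectangular_mul_closed x y : x \in U -> y \in U -> x * y \in U.
Proof.
case/andP: rectU => /andP[_ /forall_inP h] _ xU yU.
exact: (forall_inP (h x xU)).
Qed.

Lemma rectangularE x y : x \in U -> y \in U -> x * y * x = x.
Proof.
by case/andP: rectU => _ /forall_inP h xU yU; apply/eqP/(forall_inP (h x xU)).
Qed.

Lemma rectangular_idem x : x \in U -> idempotent_elt x.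
Proof.
move=> xU; have xxU := rectangular_mul_closed xU xU.
by have := rectangularE xU xxU; rewrite !mulgA (rectangularE xU xU).
Qed.

(** The relation is that of [U] itself, so multipliers must lie in [U]. From [xy = y] follows
    [yx = xyx = x], and [x] and [y] serve as each other's multipliers. *)
Lemma rectangular_greenR x y : x \in U -> y \in U ->
  greenR U x y = (x * y == y).
Proof.
move=> xU yU; apply/idP/eqP => [/eqP xy | xy].
  have : y \in right_ideal U x by rewrite xy setU11.
  case/setU1P=> [->|/imsetP[s sU ->]]; first exact: rectangular_idem.
  by rewrite mulgA rectangular_idem.
have yx : y * x = x by rewrite -{1}xy rectangularE.
apply/eqP/setP => z; apply/setU1P/setU1P => -[->|/imsetP[s sU ->]]; right.
- by rewrite -yx imset_f.
- by rewrite -yx -mulgA imset_f ?rectangular_mul_closed.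
- by rewrite -xy imset_f.
- by rewrite -xy -mulgA imset_f ?rectangular_mul_closed.
Qed.

Lemma rectangular_greenL x y : x \in U -> y \in U ->
  greenL U x y = (y * x == y).
Proof.
move=> xU yU; apply/idP/eqP => [/eqP xy | xy].
  have : y \in left_ideal U x by rewrite xy setU11.
  case/setU1P=> [->|/imsetP[s sU ->]]; first exact: rectangular_idem.
  by rewrite -mulgA rectangular_idem.
have yx : x * y = x by rewrite -{1}xy mulgA rectangularE.
apply/eqP/setP => z; apply/setU1P/setU1P => -[->|/imsetP[s sU ->]]; right.
- by rewrite -yx (imset_f (fun s => s * y)).
- by rewrite -yx mulgA (imset_f (fun s => s * y)) ?rectangular_mul_closed.
- by rewrite -xy (imset_f (fun s => s * x)).
- by rewrite -xy mulgA (imset_f (fun s => s * x)) ?rectangular_mul_closed.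
Qed.

(* Every R-class of U meets the L-class of u exactly once, and dually. *)
Lemma num_RclassesE u : u \in U -> num_Rclasses U = #|[set x in U | x * u == x]|.
Proof.
move=> uU; rewrite /num_Rclasses.
rewrite -[RHS](@card_in_imset _ _ (fun x => [set y in U | greenR U x y])).
  apply: eq_card => B; apply/imsetP/imsetP => -[x].
    move=> xU ->; have xuU := rectangular_mul_closed xU uU.
    (* [x * u] is the point where the R-class of [x] meets the L-class of [u]. *)
    exists (x * u).
      by rewrite !inE xuU -mulgA rectangular_idem //=.
    apply/setP => y; rewrite !inE; case: (boolP (y \in U)) => //= yU.
    have /eqP e : greenR U x (x * u).
      by rewrite rectangular_greenR // mulgA rectangular_idem.
    by rewrite /greenR e.
  by rewrite inE => /andP[xU _] ->; exists x.
move=> x y; rewrite !inE => /andP[xU /eqP xu] /andP[yU /eqP yu] E.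
have : y \in [set z in U | greenR U x z] by rewrite E inE yU /greenR eqxx.
rewrite inE yU rectangular_greenR //= => /eqP xy.
by rewrite -xy -{1}xu -{1}(rectangularE uU yU) !mulgA xu -mulgA yu xy.
Qed.

Lemma num_LclassesE u : u \in U -> num_Lclasses U = #|[set x in U | u * x == x]|.
Proof.
move=> uU; rewrite /num_Lclasses.
rewrite -[RHS](@card_in_imset _ _ (fun x => [set y in U | greenL U x y])).
  apply: eq_card => B; apply/imsetP/imsetP => -[x].
    move=> xU ->; have xuU := rectangular_mul_closed uU xU.
    exists (u * x).
      by rewrite !inE xuU mulgA rectangular_idem //=.
    apply/setP => y; rewrite !inE; case: (boolP (y \in U)) => //= yU.
    have /eqP e : greenL U x (u * x).
      by rewrite rectangular_greenL // -mulgA rectangular_idem.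
    by rewrite /greenL e.
  by rewrite inE => /andP[xU _] ->; exists x.
move=> x y; rewrite !inE => /andP[xU /eqP xu] /andP[yU /eqP yu] E.
have : y \in [set z in U | greenL U x z] by rewrite E inE yU /greenL eqxx.
rewrite inE yU rectangular_greenL //= => /eqP yx.
by rewrite -{1}xu -{1}(rectangularE uU yU) yu -mulgA xu yx.
Qed.

End RectangularBand.

(** * Idempotents and maximal rectangular subbands of the principal factor modulo H *)

Section PrincipalFactorModH.
Variables (S : finSemigroupType) (a : S).
Notation P := (principal_factor a).
Notation Q := (principal_factor_modH a).
Implicit Types x y e f : S.

Definition pf_class x : P := insub x.
(* Sends the elements outside the D-class to zero. *)
Definition pfH_class x : Q := \pi_Q (pf_class x).

Lemma pf_classE x (xD : x \in Dclass a) : pf_class x = Some (Sub x xD).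
Proof. by rewrite /pf_class insubT. Qed.

Lemma pf_classM x y : x \in Dclass a -> y \in Dclass a ->
  pf_class x * pf_class y = pf_class (x * y).
Proof. by move=> xD yD; rewrite pf_mulE (pf_classE xD) (pf_classE yD). Qed.

Lemma pfH_classM x y : x \in Dclass a -> y \in Dclass a ->
  pfH_class x * pfH_class y = pfH_class (x * y).
Proof. by move=> xD yD; rewrite /pfH_class -pf_classM //; apply: pfH_piM. Qed.

Lemma pf_class_eq0 x : (pf_class x == pf_zero a) = (x \notin Dclass a).
Proof. by rewrite /pf_class; case: insubP => [u /= -> _|/= ->]. Qed.

Lemma pfH_eqP (p q : P) : reflect (\pi_Q p = \pi_Q q) (greenH [set: P] p q).
Proof.
apply: (iffP idP) => [H | E].
  by apply/eqmodP.
have : greenH_equiv_rel [set: P] p q by apply/eqmodP; exact: E.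
by [].
Qed.

Lemma pfH_class_nonzero x : (pfH_class x \in pfH_nonzero a) = (x \in Dclass a).
Proof.
rewrite in_setC1 -[RHS]negbK -pf_class_eq0; congr negb.
apply/eqP/eqP => [/pfH_eqP /andP[/pf_greenL0 e _] | e].
  by apply/eqP; rewrite e.
by rewrite /pfH_class e.
Qed.

(** A multiplier producing a nonzero element is itself nonzero, so it comes from an element of
    [S]. *)
Lemma greenH_pf_class x y : x \in Dclass a ->
  greenH [set: P] (pf_class x) (pf_class y) -> greenH [set: S] x y.
Proof.
move=> xD H; have yD : y \in Dclass a.
  move/pfH_eqP: H => H; rewrite -pfH_class_nonzero /pfH_class -H.
  by rewrite -/(pfH_class x) pfH_class_nonzero.
have eq_lift u v : u \in Dclass a -> pf_class u = pf_class v -> u = v.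
  move=> uD; rewrite (pf_classE uD) /pf_class.
  by case: insubP => //= w _ <- [<-].
have mulr u v (s : P) : u \in Dclass a -> v \in Dclass a ->
    pf_class u = pf_class v * s -> exists t, u = v * t.
  move=> uD vD; case: s => [[t tD]|] E; last first.
    by move/eqP: E; rewrite pf_mul0 pf_class_eq0 uD.
  exists t; apply: eq_lift => //; rewrite -pf_classM // E; congr (_ * _).
  by rewrite (pf_classE tD).
have mull u v (s : P) : u \in Dclass a -> v \in Dclass a ->
    pf_class u = s * pf_class v -> exists t, u = t * v.
  move=> uD vD; case: s => [[t tD]|] E; last first.
    by move/eqP: E; rewrite pf_0mul pf_class_eq0 uD.
  exists t; apply: eq_lift => //; rewrite -pf_classM // E; congr (_ * _).
  by rewrite (pf_classE tD).
case/andP: H => /greenLP[l1 l2] /greenRP[r1 r2]; rewrite /greenH.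
apply/andP; split; [apply/greenLP | apply/greenRP]; split.
- by case: l1 => [/eq_lift|[s /mull]]; [left | right]; auto.
- by case: l2 => [/eq_lift|[s /mull]]; [left | right]; auto.
- by case: r1 => [/eq_lift|[s /mulr]]; [left | right]; auto.
- by case: r2 => [/eq_lift|[s /mulr]]; [left | right]; auto.
Qed.

Hypothesis orthS : orthodox_semigroup S.
Let regS : regular_semigroup S := orthS.1.

(** An H-class has at most one idempotent: [ef = e] by the L-relation and [ef = f] by the
    R-relation. *)
Lemma pfH_class_inj e f : idempotent_elt e -> idempotent_elt f ->
  e \in Dclass a -> pfH_class e = pfH_class f -> e = f.
Proof.
move=> ee ff eD /pfH_eqP /(greenH_pf_class eD) /andP[].
move=> /(regular_greenLP regS)[[s es] _] /(regular_greenRP regS)[_ [t ft]].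
have ef : e * f = e by rewrite {1}es -mulgA ff.
by rewrite -ef ft mulgA ee.
Qed.

(** If [x * x] is H-related to [x], the H-class of [x] contains an idempotent: with
    [x = t(xx) = (xx)s], it is [e = xs = tx]. *)
Lemma pfH_class_surj u : u \in pfH_nonzero a -> u * u = u ->
  exists2 e, idempotent_elt e /\ e \in Dclass a & u = pfH_class e.
Proof.
elim/quotW: u => -[x0|]; last by rewrite in_setC1 eqxx.
pose x := val x0; have xD : x \in Dclass a := valP x0.
have -> : \pi_Q (Some x0 : P) = pfH_class x.
  by rewrite /pfH_class (pf_classE xD); congr (\pi_Q _); congr Some; apply: val_inj.
rewrite pfH_classM // => _ E.
have xxD : x * x \in Dclass a by rewrite -pfH_class_nonzero E pfH_class_nonzero.
move/pfH_eqP: (E) => /(greenH_pf_class xxD) /andP[].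
move=> /(regular_greenLP regS)[_ [t tE]] /(regular_greenRP regS)[_ [s sE]].
pose e := x * s.
have ex : t * x = e by rewrite {1}sE mulgA -tE.
have lex : e * x = x by rewrite -ex -mulgA -tE.
have rxe : x * e = x by rewrite /e mulgA -sE.
have ee : idempotent_elt e by rewrite /idempotent_elt -{1}ex /e mulgA -(mulgA t) -tE.
have eD : e \in Dclass a.
  apply: (Dclass_greenR xD); apply/(regular_greenRP regS).
  by split; [exists x | exists s].
clearbody e; exists e => //; apply/esym/pfH_eqP/andP; split.
  have := @pf_greenL_mull _ _ (pf_class e) (pf_class x).
  by rewrite pf_classM // rxe pf_class_eq0 xD; apply.
have := @pf_greenR_mulr _ _ (pf_class e) (pf_class x).
by rewrite pf_classM // lex pf_class_eq0 xD; apply.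
Qed.

Definition pfH_band e : {set Q} := [set pfH_class x | x in inverses e].

Section Band.
Variable e : S.
Hypotheses (ee : idempotent_elt e) (eD : e \in Dclass a).

Let inv_D x : inverse_of e x -> x \in Dclass a.
Proof. exact: Dclass_inverse. Qed.

Lemma pfH_band_id : pfH_class e \in pfH_band e.
Proof. by apply/imset_f/inversesP/inverse_of_idem. Qed.

Lemma pfH_band_nonzero : pfH_band e \subset pfH_nonzero a.
Proof.
by apply/subsetP => _ /imsetP[x /inversesP ex ->]; rewrite pfH_class_nonzero inv_D.
Qed.

Lemma pfH_band_rectangular : rectangular_subband (pfH_band e).
Proof.
apply/andP; split;
  [apply/andP; split; first by apply/set0Pn; exists (pfH_class e); exact: pfH_band_id|];
  apply/forall_inP => _ /imsetP[x /inversesP ex ->];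
  apply/forall_inP => _ /imsetP[y /inversesP ey ->];
  have exy := inverses_idem_mul orthS ee ex ey;
  rewrite (pfH_classM (inv_D ex) (inv_D ey)).
- exact/imset_f/inversesP.
- rewrite (pfH_classM (inv_D exy) (inv_D ex)).
  by have [-> _] := inverses_idem_rect orthS ee ex ey.
Qed.

(** Lift an element of [U] to an idempotent [f]. The rectangular law only says that [efe] and [e]
    have the same class, but both are idempotent by orthodoxy, hence equal; likewise [fef = f]. *)
Lemma rectangular_sub_pfH_band (U : {set Q}) : rectangular_subband U ->
  U \subset pfH_nonzero a -> pfH_class e \in U -> U \subset pfH_band e.
Proof.
move=> rectU U0 eU; apply/subsetP => u uU.
have [f [ff fD] uE] := pfH_class_surj (subsetP U0 u uU) (rectangular_idem rectU uU).
rewrite uE; apply/imset_f/inversesP.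
have efU : pfH_class (e * f) \in U.
  by rewrite -pfH_classM // -uE rectangular_mul_closed.
have efD : e * f \in Dclass a by rewrite -pfH_class_nonzero (subsetP U0).
have feU : pfH_class (f * e) \in U.
  by rewrite -pfH_classM // -uE rectangular_mul_closed.
have feD : f * e \in Dclass a by rewrite -pfH_class_nonzero (subsetP U0).
split; apply/esym; apply: pfH_class_inj => //; try by apply: orthS.2 => //; apply: orthS.2.
- by rewrite -pfH_classM // -pfH_classM // -uE (rectangularE rectU).
- by rewrite -pfH_classM // -pfH_classM // -uE (rectangularE rectU).
Qed.

(** R-classes are counted along the L-class of the image of [e], hence the exchange of sides; no two
    inverses of [e] are identified, as all are idempotent. *)
Lemma num_Rclasses_pfH_band : num_Rclasses (pfH_band e) = #|Linverses e|.
Proof.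
rewrite (num_RclassesE pfH_band_rectangular pfH_band_id).
rewrite -(@card_in_imset _ _ pfH_class (Linverses e)).
  apply: eq_card => u; rewrite inE; apply/andP/imsetP.
    move=> [/imsetP[x xe ->]] /eqP E; exists x => //; rewrite inE xe /=.
    have /inversesP ex := xe.
    have exe := inverses_idem_mul orthS ee ex (inverse_of_idem ee).
    have eqq := inverse_idem_idem orthS ee.
    apply/eqP; apply: pfH_class_inj;
      [exact: eqq exe | exact: eqq ex | exact: inv_D|].
    by rewrite -(pfH_classM (inv_D ex) eD).
  move=> [x]; rewrite inE => /andP[xe /eqP xE] ->; have /inversesP ex := xe.
  by rewrite imset_f // (pfH_classM (inv_D ex) eD) xE.
move=> x y /setIdP[/inversesP ex _] /setIdP[/inversesP ey _].
apply: pfH_class_inj; last exact: inv_D.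
  exact: inverse_idem_idem ex.
exact: inverse_idem_idem ey.
Qed.

Lemma num_Lclasses_pfH_band : num_Lclasses (pfH_band e) = #|Rinverses e|.
Proof.
rewrite (num_LclassesE pfH_band_rectangular pfH_band_id).
rewrite -(@card_in_imset _ _ pfH_class (Rinverses e)).
  apply: eq_card => u; rewrite inE; apply/andP/imsetP.
    move=> [/imsetP[x xe ->]] /eqP E; exists x => //; rewrite inE xe /=.
    have /inversesP ex := xe.
    have exe := inverses_idem_mul orthS ee (inverse_of_idem ee) ex.
    have eqq := inverse_idem_idem orthS ee.
    apply/eqP; apply: pfH_class_inj;
      [exact: eqq exe | exact: eqq ex | exact: inv_D|].
    by rewrite -(pfH_classM eD (inv_D ex)).
  move=> [x]; rewrite inE => /andP[xe /eqP xE] ->; have /inversesP ex := xe.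
  by rewrite imset_f // (pfH_classM eD (inv_D ex)) xE.
move=> x y /setIdP[/inversesP ex _] /setIdP[/inversesP ey _].
apply: pfH_class_inj; last exact: inv_D.
  exact: inverse_idem_idem ex.
exact: inverse_idem_idem ey.
Qed.

End Band.

Lemma maximal_rectangular_subbandP U :
  maximal_rectangular_subband (pfH_nonzero a) U <->
  exists e, [/\ idempotent_elt e, e \in Dclass a & U = pfH_band e].
Proof.
split=> [/maxsetP[/andP[rectU U0] maxU] | [e [ee eD ->]]].
  have /set0Pn[u uU] : U != set0 by case/andP: rectU => /andP[].
  have [e [ee eD] uE] := pfH_class_surj (subsetP U0 u uU) (rectangular_idem rectU uU).
  exists e; split=> //; apply/esym/maxU.
    by rewrite pfH_band_rectangular // pfH_band_nonzero.
  by apply: rectangular_sub_pfH_band; rewrite // -uE.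
apply/maxsetP; split; first by rewrite pfH_band_rectangular // pfH_band_nonzero.
move=> V /andP[rectV V0] eV; apply/eqP; rewrite eqEsubset eV andbT.
by apply: rectangular_sub_pfH_band => //; apply: (subsetP eV); apply: pfH_band_id.
Qed.

(** Cross-multiplication; the denominators are nonzero because an idempotent belongs to its own
    [Rinverses]. *)
Lemma similar_pfH_bandE e f : idempotent_elt e -> idempotent_elt f ->
    e \in Dclass a -> f \in Dclass a ->
  similar_bands (pfH_band e) (pfH_band f) <->
  (#|Rinverses e| * #|Linverses f|)%N = (#|Rinverses f| * #|Linverses e|)%N.
Proof.
move=> ee ff eD fD; rewrite /similar_bands !num_Rclasses_pfH_band //.
rewrite !num_Lclasses_pfH_band //.
have pos g : idempotent_elt g -> (#|Rinverses g|%:R != 0 :> rat)%R.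
  move=> gg; rewrite Num.Theory.pnatr_eq0 -lt0n; apply/card_gt0P; exists g.
  by rewrite inE gg eqxx andbT; apply/inversesP/inverse_of_idem.
split=> [/eqP | E].
  rewrite GRing.eqr_div ?pos // -!GRing.natrM Num.Theory.eqr_nat => /eqP E.
  by rewrite mulnC -E mulnC.
apply/eqP; rewrite GRing.eqr_div ?pos // -!GRing.natrM Num.Theory.eqr_nat.
by rewrite mulnC -E mulnC.
Qed.

End PrincipalFactorModH.

Theorem theorem3p7 (S : finSemigroupType) (hS : orthodox_semigroup S) :
  (exists f : S -> S, permutation_matching f) <->
  (forall (a : S) (U1 U2 : {set principal_factor_modH a}),
     maximal_rectangular_subband (pfH_nonzero a) U1 ->
     maximal_rectangular_subband (pfH_nonzero a) U2 ->
     similar_bands U1 U2).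
Proof.
apply: (iff_trans (permutation_matching_card hS)); split=> [card_eq a U1 U2 | sim a b ab].
  move=> /(maximal_rectangular_subbandP hS)[e [ee eD ->]].
  move=> /(maximal_rectangular_subbandP hS)[f [ff fD ->]].
  apply/(similar_pfH_bandE hS ee ff eD fD).
  (* Writing [e] and [f] as [b * b'] and [b' * b] turns the two products into the numbers of
     inverses of [b] and of [b']. *)
  have [b [b' [bb' <- <-]]] := Dclass_idem_inverse hS.1 ee ff eD fD.
  by rewrite -(card_inverses bb') -(card_inverses (inverse_ofC bb')); apply: card_eq.
have ba := inverse_ofC ab.
have [ee ff] := (idem_mul_inverse ab, idem_mul_inverse ba).
have aD := Dclass_refl a.
have bD := Dclass_inverse hS.1 aD ab.
have eD : a * b \in Dclass a.
  apply: (Dclass_greenR aD); apply/(regular_greenRP hS.1).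
  by case: ab => aba _; split; [exists a | exists b].
have fD : b * a \in Dclass a.
  apply: (Dclass_greenR bD); apply/(regular_greenRP hS.1).
  by case: ba => bab _; split; [exists b | exists a].
rewrite (card_inverses ab) (card_inverses ba).
apply/(similar_pfH_bandE hS ee ff eD fD).
by apply: sim; apply/(maximal_rectangular_subbandP hS); [exists (a * b) | exists (b * a)].
Qed.
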